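(* Let $\nu\in\nu_0+\mathbb{N}$, and let $B_n^{(\alpha,\nu)}$, $C_n^{(\alpha,\nu)}$ be the coefficients in the three-term recurrence relation $$xP_n^{(\alpha,\nu)}(x)=P_{n+1}^{(\alpha,\nu)}(x)+B_n^{(\alpha,\nu)}P_n^{(\alpha,\nu)}(x)+C_n^{(\alpha,\nu)}P_{n-1}^{(\alpha,\nu)}(x)$$ of the monic matrix valued Hermite type polynomials. Then, for $t\in\mathbb{R}$, $$C_n(t)=\exp\bigl(-\tfrac t2A^\alpha\bigr)C_n^{(\alpha,\nu)}\exp\bigl(\tfrac t2A^\alpha\bigr),\qquad B_n(t)=\exp\bigl(-\tfrac t2A^\alpha\bigr)B_n^{(\alpha,\nu)}\exp\bigl(\tfrac t2A^\alpha\bigr)-\tfrac12t$$ solve the non-abelian Toda lattice equations $$\dot C_n(t)=C_n(t)B_{n-1}(t)-B_n(t)C_n(t)\quad(n\ge1),\qquad \dot B_n(t)=C_n(t)-C_{n+1}(t)\quad(n\ge0),$$ where the dot denotes the derivative with respect to $t$.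
   Context: $N\ge1$ is an integer, $\mathbb{N}=\{0,1,2,\dots\}$. Scalars in matrix expressions denote multiples of the identity, and $^\ast$ is the conjugate transpose. $H_n$ are the Hermite polynomials defined by $\sum_{n\ge0}\frac{t^n}{n!}H_n(x)=e^{2xt-t^2}$. $L(x)$ is the lower triangular $N\times N$ matrix with $L(x)_{m,n}=\frac{H_{m-n}(x)}{(m-n)!}$ for $m\ge n$ and $0$ for $m<n$, $m,n\in\{1,\dots,N\}$. $A=2\sum_{j=2}^NE_{j,j-1}$ with $E_{j,k}$ the matrix units. $\alpha_1,\dots,\alpha_N$ are non-zero real numbers with $\alpha_1=1$, $S^\alpha=\mathrm{diag}(\alpha_1,\dots,\alpha_N)$, $L^\alpha(x)=S^\alpha L(x)(S^\alpha)^{-1}$, $A^\alpha=S^\alpha A(S^\alpha)^{-1}$, $J=\mathrm{diag}(1,2,\dots,N)$. Fix $\nu_0$. For each $\nu\in\nu_0+\mathbb{N}$ let $\Delta^{(\nu)}=\mathrm{diag}(\delta_1^{(\nu)},\dots,\delta_N^{(\nu)})$ have positive diagonal entries and let $c^{(\nu)},d^{(\nu)}$ be positive reals. Standing assumptions: for all $\nu\in\nu_0+\mathbb{N}$, $$\Delta^{(\nu+1)}=(d^{(\nu)}J+c^{(\nu)})\Delta^{(\nu)},\qquad \frac{\alpha_{k+1}^2}{\alpha_k^2}=\frac{d^{(\nu)}k(N-k)}{2(d^{(\nu)}k+c^{(\nu)})}\frac{\delta_{k+1}^{(\nu)}}{\delta_k^{(\nu)}},\quad k=1,\dots,N-1.$$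 The weight on $\mathbb{R}$ is $W^{(\alpha,\nu)}(x)=e^{-x^2}L^\alpha(x)\Delta^{(\nu)}L^\alpha(x)^\ast$, and $P_n^{(\alpha,\nu)}$ is the unique matrix polynomial of degree $n$ with leading coefficient the identity such that $\int_{\mathbb{R}}P_n^{(\alpha,\nu)}(x)W^{(\alpha,\nu)}(x)P_m^{(\alpha,\nu)}(x)^\ast dx=0$ for $n\neq m$; conventions $P_{-1}^{(\alpha,\nu)}=0$, $C_0^{(\alpha,\nu)}=0$. *)

(* Defs.v *)
From HB Require Import structures.
From mathcomp Require Import all_boot all_order all_algebra.
From mathcomp Require Import complex.
From mathcomp Require Import all_classical all_reals all_analysis.

Set Implicit Arguments.
Unset Strict Implicit.
Unset Printing Implicit Defensive.

Import Order.TTheory GRing.Theory Num.Theory.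
Import numFieldNormedType.Exports.

Local Open Scope classical_set_scope.
Local Open Scope ring_scope.
Local Open Scope complex_scope.
Local Open Scope sesquilinear_scope.

(* The matrix size N >= 1 is written p.+1.  The sequences alpha and delta^(nu)
   are functions on nat of which only the values at 1, ..., N are used: the
   matrix index i : 'I_N corresponds to the 1-based index i.+1. *)

Section ComplexMatrices.
Variables (R : realType) (p : nat).
Local Notation N := p.+1.

Definition mxC (M : 'M[R]_N) : 'M[R[i]]_N := map_mx (real_complex R) M.

Definition mxRe (M : 'M[R[i]]_N) : 'M[R]_N := map_mx (@complex.Re R) M.

Definition mxIm (M : 'M[R[i]]_N) : 'M[R]_N := map_mx (@complex.Im R) M.

(* A complex matrix function of a real variable is differentiated through its
   real and imaginary parts, R[i] not being a normed space over R here. *)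
Definition is_mxderive (F : R -> 'M[R[i]]_N) (t : R) (D : 'M[R[i]]_N) : Prop :=
  is_derive t 1 (fun s => mxRe (F s)) (mxRe D) /\
  is_derive t 1 (fun s => mxIm (F s)) (mxIm D).

Definition mxintegral (F : R -> 'M[R[i]]_N) : 'M[R[i]]_N :=
  \matrix_(i, j)
    ((\int[@lebesgue_measure R]_(x in setT) complex.Re (F x i j))
     +i* (\int[@lebesgue_measure R]_(x in setT) complex.Im (F x i j)))%R.

Definition mxexp (M : 'M[R]_N) : 'M[R]_N :=
  limn (series (fun k : nat => (k`!%:R)^-1 *: M ^+ k)).

Definition mpeval (Q : {poly 'M[R[i]]_N}) (x : R) : 'M[R[i]]_N :=
  Q.[(x%:C)%:M].

Definition monic_orthogonal (W : R -> 'M[R[i]]_N)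
    (P : nat -> {poly 'M[R[i]]_N}) : Prop :=
  (forall n, size (P n) = n.+1 /\ P n \is monic) /\
  (forall n m, n <> m ->
     mxintegral (fun x => mpeval (P n) x *m W x *m (mpeval (P m) x)^t*) = 0).

(* P_{n-1}, with the convention P_{-1} = 0. *)
Definition mpprev (P : nat -> {poly 'M[R[i]]_N}) (n : nat) :
    {poly 'M[R[i]]_N} :=
  if n is k.+1 then P k else 0.

Definition three_term_recurrence (P : nat -> {poly 'M[R[i]]_N})
    (B C : nat -> 'M[R[i]]_N) : Prop :=
  C 0%N = 0 /\
  forall n (x : R),
    x%:C *: mpeval (P n) x =
    mpeval (P n.+1) x + B n *m mpeval (P n) x + C n *m mpeval (mpprev P n) x.

Definition toda_lattice (B C : nat -> R -> 'M[R[i]]_N) : Prop :=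
  forall t : R,
    (forall n, (1 <= n)%N ->
       is_mxderive (C n) t (C n t *m B n.-1 t - B n t *m C n t)) /\
    (forall n, is_mxderive (B n) t (C n t - C n.+1 t)).

End ComplexMatrices.

Section HermiteWeight.
Variables (R : realType) (p : nat).
Local Notation N := p.+1.

(* Convergence of the generating series for all real x and t determines H. *)
Definition hermite_polynomials (H : nat -> {poly R}) : Prop :=
  forall x t : R,
    series (fun n : nat => t ^+ n / n`!%:R * (H n).[x]) @ \oo -->
      expR (2 * x * t - t ^+ 2).

Definition diagmx (a : nat -> R) : 'M[R]_N := diag_mx (\row_i a i.+1).

Definition Jmx : 'M[R]_N := diagmx (fun k => k%:R).

Definition Lmx (H : nat -> {poly R}) (x : R) : 'M[R]_N :=
  \matrix_(i, j)
    if (j <= i)%N then (H (i - j)%N).[x] / (i - j)`!%:R else 0.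

Definition Amx : 'M[R]_N :=
  \matrix_(i, j) if i == j.+1 :> nat then 2 else 0.

Definition conj_alpha (alpha : nat -> R) (M : 'M[R]_N) : 'M[R]_N :=
  diagmx alpha *m M *m invmx (diagmx alpha).

Definition hermite_weight (H : nat -> {poly R}) (alpha delta : nat -> R)
    (x : R) : 'M[R[i]]_N :=
  let La := mxC (conj_alpha alpha (Lmx H x)) in
  (expR (- x ^+ 2))%:C *: (La *m mxC (diagmx delta) *m La^t*).

End HermiteWeight.

Arguments diagmx {R} p a.
Arguments Jmx {R} p.
Arguments Amx {R} p.
Arguments hermite_weight {R} p H alpha delta x.

(* Main.v *)
Require Import Defs.
From HB Require Import structures.
From mathcomp Require Import all_boot all_order all_algebra.
From mathcomp Require Import complex.
From mathcomp Require Import all_classical all_reals all_analysis.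
From mathcomp Require Import measurable_realfun ring lra.

Set Implicit Arguments.
Unset Strict Implicit.
Unset Printing Implicit Defensive.

Import Order.TTheory GRing.Theory Num.Theory.
Import numFieldNormedType.Exports.

Local Open Scope ring_scope.
Local Open Scope complex_scope.

(** Write the weight as e^(-x^2) V(x) with V = La Delta La^*, and let A stand
    for A^alpha.  Everything rests on the Pearson equation
                      V' = A V + V A^*,
    which holds because the generating function of the Hermite polynomials
    gives H_n' = 2n H_(n-1), hence La' = A La  ([deriv_hermite_poly_mx],
    [pearson_hermite]).

    Let <Q1, Q2> be the integral of e^(-x^2) Q1 V Q2^*, and put
    D Q = Q' + Q A, which commutes with left multiplication by constants.
    Integration by parts and the Pearson equation give
                <D Q1, Q2> + <Q1, D Q2> = 2 <x Q1, Q2>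
    ([gauss_form_twisted_deriv]).  Since D raises no degree, for m < n this
    yields <D P_n, P_m> = 2 <x P_n, P_m> = 2 C_n <P_(n-1), P_m>.  The polynomial
    D P_n - A P_n - 2 C_n P_(n-1) has degree less than n, so it vanishes because
    the form is definite:
                     D P_n = A P_n + 2 C_n P_(n-1)
    ([lowering]).  Applying D to the three-term recurrence, using the lowering
    relation on both sides, and comparing the coefficients of P_n and P_(n-1)
    produces two identities between constant matrices ([toda_coef]):
            A B_n - B_n A + 1 = 2 (C_(n+1) - C_n),
            A C_n - C_n A     = 2 (B_n C_n - C_n B_(n-1)).
    These are the Toda equations at t = 0, and conjugation by exp(t A / 2)
    carries them to every t ([toda_flow]).

    Analysis enters only through the Gaussian moments and the uniqueness of
    power series.  The integrands, the weight and the matrix exponentials (A is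
    nilpotent) are all evaluations of polynomials with matrix coefficients at
    real points, and the argument is carried out in the ring of those
    polynomials. *)

(** * Polynomials against the Gaussian weight *)

Section GaussianIntegral.
Variable R : realType.
Local Open Scope classical_set_scope.
Implicit Types (q : {poly R}) (x a : R).
Local Notation mu := (@lebesgue_measure R).

Definition gauss_poly q x : R := expR (- x ^+ 2) * q.[x].

(** Induction on the polynomial: half of the exponent bounds the shorter
    polynomial and the other half bounds the extra factor [x]. *)
Lemma horner_expR_bound q a : 0 < a ->
  exists2 K : R, 0 <= K & forall x, `|q.[x]| <= K * expR (a * x ^+ 2).
Proof.
elim/poly_ind: q a => [|q c IHq] a a0.
  by exists 0 => // x; rewrite horner0 normr0 mul0r.
have a20 : 0 < a / 2 by rewrite divr_gt0.
have [K K0 qK] := IHq _ a20.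
exists (K * (1 + (a / 2)^-1) + `|c|).
  by rewrite addr_ge0// mulr_ge0// addr_ge0// invr_ge0 ltW.
move=> x; rewrite hornerMXaddC (le_trans (ler_normD _ _))// mulrDl lerD//.
  rewrite (_ : a * x ^+ 2 = a / 2 * x ^+ 2 + a / 2 * x ^+ 2); last by field.
  rewrite expRD normrM mulrACA ler_pM//.
  have e1 : 1 + a / 2 * x ^+ 2 <= expR (a / 2 * x ^+ 2) by exact: expR_ge1Dx.
  rewrite (@le_trans _ _ ((1 + (a / 2)^-1) * (1 + a / 2 * x ^+ 2)))//.
    have -> : (1 + (a / 2)^-1) * (1 + a / 2 * x ^+ 2) =
        1 + (a / 2)^-1 + a / 2 * x ^+ 2 + x ^+ 2 by field; rewrite gt_eqF.
    have x1 : `|x| <= 1 + `|x| ^+ 2 by have := sqr_ge0 (`|x| - 1); nra.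
    rewrite (le_trans x1)// real_normK ?num_real//.
    have := sqr_ge0 x; have : 0 < (a / 2)^-1 by rewrite invr_gt0.
    by move: a20; nra.
  by rewrite ler_wpM2l// addr_ge0// invr_ge0 ltW.
by rewrite ler_peMr// -[1]expR0 ler_expR mulr_ge0 ?sqr_ge0// ltW.
Qed.

Lemma continuous_gauss_poly q : continuous (gauss_poly q).
Proof.
move=> x; apply: cvgM; last exact: continuous_horner.
exact: continuous_gauss_fun.
Qed.

Lemma measurable_gauss_poly q : measurable_fun [set: R] (gauss_poly q).
Proof.
apply: continuous_measurable_fun; exact: continuous_gauss_poly.
Qed.

(** Half of the exponent absorbs the polynomial; what remains is a multiple of
    the standard normal density. *)
Lemma integrable_gauss_poly q : mu.-integrable [set: R] (EFin \o gauss_poly q).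
Proof.
have [K K0 qK] := @horner_expR_bound q 2^-1 ltac:(by []).
have p0 : 0 < normal_peak (1 : R) by exact: normal_peak_gt0.
apply: (@le_integrable _ _ _ mu _ measurableT _
  (fun x => (K / normal_peak 1)%:E * (normal_pdf 0 1 x)%:E)%E).
- by apply/measurable_EFinP; exact: measurable_gauss_poly.
- move=> x _ /=; rewrite lee_fin {1}/gauss_poly normrM (ger0_norm (expR_ge0 _)).
  have -> : normal_pdf 0 1 x = normal_peak 1 * normal_fun 0 1 x.
    by rewrite normal_pdfE// oner_eq0.
  rewrite mulrA mulfVK ?gt_eqF//.
  rewrite /normal_fun subr0 expr1n (ger0_norm (mulr_ge0 K0 (expR_ge0 _))).
  apply: le_trans (ler_wpM2l (expR_ge0 _) (qK x)) _; rewrite mulrCA -expRD.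
  by rewrite (_ : _ + _ = - x ^+ 2 / (1 *+ 2))//; field.
- by apply: integrableZl => //; exact: integrable_normal_pdf.
Qed.

Lemma is_derive_gauss_poly q x :
  is_derive x (1 : R) (gauss_poly q) (gauss_poly (q^`() - 2%:P * 'X * q) x).
Proof.
have eD : is_derive x (1 : R) (fun y => expR (- y ^+ 2))
    (expR (- x ^+ 2) * (- 2 * x)).
  apply: (@is_derive1_comp _ expR (fun y => - y ^+ 2)).
  by apply: is_derive_eq; rewrite [_ *: _]mulr1 /=; ring.
apply: is_derive_eq; rewrite /gauss_poly !hornerE /=.
by rewrite ![_ *: _]mulrC; ring.
Qed.

(** The sign [(-1) ^+ s] treats both ends of the line at once. *)
Lemma cvg_gauss_poly q (s : bool) :
  gauss_poly q ((-1) ^+ s * n.+1%:R) @[n --> \oo] --> (0 : R).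
Proof.
(* Bounding [q * 'X] rather than [q] leaves the decay K / (n + 1). *)
have [K K0 qK] := @horner_expR_bound (q * 'X) 1 ltac:(by []).
apply/norm_cvg0P.
apply: (@squeeze_cvgr _ _ _ _ (cst 0) (fun n => K * harmonic n)).
- apply: nearW => n /=; rewrite normr_ge0/=.
  rewrite /harmonic/= ler_pdivlMr// normrM (ger0_norm (expR_ge0 _)).
  set y := _ * n.+1%:R.
  have -> : n.+1%:R = `|y| :> R.
    by rewrite normrM normrX normrN1 expr1n mul1r normr_nat.
  rewrite -mulrA -normrM -hornerMX.
  rewrite (le_trans (ler_wpM2l (expR_ge0 _) (qK y)))// mulrCA -expRD.
  by rewrite mul1r addNr expR0 mulr1.
- exact: cvg_cst.
- by rewrite -[X in _ --> X](mulr0 K); apply: cvgM (cvg_cst _) _;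
    exact: cvg_harmonic.
Qed.

(** The difference of the integrands is the derivative of e^(-x^2) q(x): its
    integral over [-n-1, n+1] is a boundary term that tends to 0, and converges
    to the integral over the line by dominated convergence. *)
Lemma Rintegral_gauss_poly_deriv q :
  (\int[mu]_(x in setT) gauss_poly q^`() x)%R =
  (\int[mu]_(x in setT) gauss_poly (2%:P * 'X * q) x)%R.
Proof.
apply/eqP; rewrite -subr_eq0 -RintegralB//; try exact: integrable_gauss_poly.
set r := q^`() - 2%:P * 'X * q.
under eq_Rintegral => x _.
  rewrite /gauss_poly -mulrBr -hornerN -hornerD -/r -/(gauss_poly r x); over.
pose D n : set R := `[- n.+1%:R, n.+1%:R].
have cvgD : (\int[mu]_(x in D n) (gauss_poly r x)%:E)%E @[n --> \oo] -->
    (\int[mu]_x (gauss_poly r x)%:E)%E.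
  under eq_fun do rewrite integral_mkcond.
  apply: (@dominated_cvg _ _ R mu setT measurableT
    (fun n => (fun x => (gauss_poly r x)%:E) \_ (D n))
    (fun x => (gauss_poly r x)%:E) (fun x => (`|gauss_poly r x|)%:E)).
  - move=> n; apply/(measurable_restrictT _ _).1; first exact: measurable_itv.
    apply: measurable_funTS; apply/measurable_EFinP.
    exact: measurable_gauss_poly.
  - move=> x _; apply: cvg_near_cst.
    near=> n; rewrite patchE mem_set// /D/= in_itv/= -ler_norml.
    have : `|x| <= n%:R by near: n; exact: nbhs_infty_ger.
    by move=> /le_trans; apply; rewrite ler_nat.
  - by [].
  - exact: integrable_norm (integrable_gauss_poly r).
  - move=> n x _; rewrite patchE; case: ifPn => _ /=; first by rewrite lee_fin.
    by rewrite normr0 lee_fin.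
have cvg0 : (\int[mu]_(x in D n) (gauss_poly r x)%:E)%E @[n --> \oo] --> 0%E.
  under eq_fun => n.
    rewrite (@continuous_FTC2 _ _ (gauss_poly q)); first over.
    - by rewrite gtrN.
    - by apply: continuous_subspaceT; exact: continuous_gauss_poly.
    - split => [x _||]; first by have [] := is_derive_gauss_poly q x.
      + exact/cvg_at_right_filter/continuous_gauss_poly.
      + exact/cvg_at_left_filter/continuous_gauss_poly.
    - by move=> x _; rewrite derive1E; have [_ ->] := is_derive_gauss_poly q x.
  rewrite -[0%E]/((0 : R)%:E) -[X in X%:E](subr0 0).
  under eq_fun do rewrite -EFinB.
  apply: cvg_EFin; first exact: nearW.
  apply: cvgB.
    by have := @cvg_gauss_poly q false; under eq_fun do rewrite expr0 mul1r.
  by have := @cvg_gauss_poly q true; under eq_fun do rewrite expr1 mulN1r.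
by rewrite /Rintegral (cvg_unique _ cvgD cvg0).
Unshelve. all: by end_near. Qed.

Lemma finite_roots (s : {poly R}) : s != 0 -> finite_set [set x | root s x].
Proof.
move=> s0; apply: contrapT => /(@infinite_set_fset _ _ (size s)) [B Bs szB].
move/eqP: s0; apply; apply: (roots_geq_poly_eq0 _ (finmap.fset_uniq B) szB).
by apply/allP => x xB; exact: Bs.
Qed.

Lemma poly0_of_horner (s : {poly R}) : (forall x, s.[x] = 0) -> s = 0.
Proof.
move=> s0; apply/eqP; apply: contraT => /finite_roots.
rewrite (_ : [set x | _] = setT); last first.
  by apply/seteqP; split => // x _; apply/rootP.
move=> /finite_set_countable/countable_lebesgue_measure0 T0.
have : (mu `[0%R, 1%R] <= mu setT)%E by apply: le_measure; rewrite ?inE.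
by rewrite T0 lebesgue_measure_itv /= lte_fin ltr01 oppr0 adde0 lee_fin ler10.
Qed.

(** A vanishing integral of a nonnegative function makes it vanish almost
    everywhere, while a nonzero polynomial vanishes on a finite set only. *)
Lemma gauss_poly_definite (s : {poly R}) : (forall x, 0 <= s.[x]) ->
  (\int[mu]_(x in setT) gauss_poly s x)%R = 0 -> s = 0.
Proof.
move=> s0 Is; apply/eqP; apply: contraT => sN0.
have : (\int[mu]_(x in setT) `|(gauss_poly s x)%:E|)%E = 0%E.
  transitivity (\int[mu]_(x in setT) (gauss_poly s x)%:E)%E.
    apply: eq_integral => x _.
    by rewrite gee0_abs// lee_fin mulr_ge0 ?expR_ge0.
  rewrite -[LHS]fineK; last exact: integrable_fin_num (integrable_gauss_poly s).
  by move: Is; rewrite /Rintegral => ->.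
have mg : measurable_fun setT (EFin \o gauss_poly s).
  by apply/measurable_EFinP; exact: measurable_gauss_poly.
move/(ae_eq_integral_abs mu measurableT mg) => [Z [mZ Z0 sZ]].
have R0 := countable_lebesgue_measure0 (finite_set_countable (finite_roots sN0)).
have mR : measurable [set x | root s x].
  apply: countable_measurable; first by move=> t; exact: measurable_set1.
  exact/finite_set_countable/finite_roots.
have : (mu `[0%R, 1%R] <= mu (Z `|` [set x | root s x]))%E.
  apply: le_measure; rewrite ?inE//; first exact: measurableU.
  move=> x _; have [rx|rx] := boolP (root s x); [by right|left; apply: sZ].
  move=> /(_ I) [] /eqP; rewrite mulf_eq0 gt_eqF ?expR_gt0//=.
  by rewrite -rootE (negbTE rx).
rewrite measureU0// Z0.
by rewrite lebesgue_measure_itv /= lte_fin ltr01 oppr0 adde0 lee_fin ler10.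
Qed.

Definition gauss_moment k : R := (\int[mu]_(x in setT) gauss_poly 'X^k x)%R.

Lemma Rintegral_gauss_poly n q : (size q <= n)%N ->
  (\int[mu]_(x in setT) gauss_poly q x)%R = \sum_(k < n) gauss_moment k * q`_k.
Proof.
elim: n q => [|n IHn] q sq.
  move: sq; rewrite leqn0 size_poly_eq0 => /eqP ->; rewrite big_ord0.
  under eq_Rintegral do rewrite /gauss_poly horner0 mulr0.
  by rewrite Rintegral_cst// mul0r.
pose r := take_poly n q.
have qE : q = r + q`_n *: 'X^n.
  apply/polyP => i; rewrite coefD coef_take_poly coefZ coefXn.
  case: ltngtP => [|ni|->]; rewrite ?mulr0 ?mulr1 ?addr0 ?add0r//.
  by rewrite nth_default// (leq_trans sq).
rewrite big_ord_recr /= mulrC.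
transitivity (\int[mu]_(x in setT) (gauss_poly r x + q`_n * gauss_poly 'X^n x))%R.
  apply: eq_Rintegral => x _.
  by rewrite /gauss_poly {1}qE hornerD hornerZ mulrDr mulrCA.
rewrite RintegralD//; last 2 first.
  - exact: integrable_gauss_poly.
  - exact: (integrableZl measurableT _ (integrable_gauss_poly _)).
rewrite RintegralZl//; last exact: integrable_gauss_poly.
rewrite (IHn r) ?size_take_poly//; congr (_ + _).
by apply: eq_bigr => i _; rewrite coef_take_poly ltn_ord.
Qed.

Lemma gauss_moment_rec k :
  k%:R * gauss_moment k.-1 = 2 * gauss_moment k.+1.
Proof.
have := Rintegral_gauss_poly_deriv 'X^k; rewrite derivXn -mulrA -exprS.
under eq_Rintegral do
  rewrite /gauss_poly hornerMn -mulr_natl mulrCA.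
under [in RHS]eq_Rintegral do rewrite /gauss_poly hornerM hornerC mulrCA.
by rewrite !RintegralZl//; exact: integrable_gauss_poly.
Qed.

End GaussianIntegral.

(** * Hermite polynomials from their generating function *)

Section HermitePolynomials.
Variable R : realType.
Local Open Scope classical_set_scope.


Definition entire_series (a : R^nat) (f : R -> R) :=
  forall t, pseries a t @ \oo --> f t.

(** The factor n + 1 of the differentiated series is at most 2^(n+1), so
    absolute convergence at 2 (1 + |t|) dominates it. *)
Lemma entire_series_diffs_cvg a f : entire_series a f ->
  forall t, cvgn (pseries (pseries_diffs a) t).
Proof.
move=> af t.
pose s : R := 2 * (1 + `|t|).
have s0 : 0 <= s by rewrite mulr_ge0// addr_ge0.
have cs : cvgn (pseries (fun n => `|a n|) s).
  apply: (@is_cvg_pseries_inside_norm _ _ (s + 1)).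
    by apply/cvg_ex; exists (f (s + 1)); exact: af.
  by rewrite !ger0_norm// ?addr_ge0// ltrDl.
apply: normed_cvg.
have cs1 : cvgn (series (fun n => `|a n.+1| * s ^+ n.+1)).
  set u := fun n => `|a n| * s ^+ n.
  have -> : series (fun n => u n.+1) = (fun n => series u n.+1 - u 0%N).
    apply/funext => n; rewrite /series/= [in RHS]big_nat_recl//=.
    by rewrite [RHS]addrC addKr.
  apply: is_cvgB; last exact: is_cvg_cst.
  by apply/cvg_ex; exists (limn (series u)); rewrite (cvg_shiftS (series u)).
apply: series_le_cvg cs1 => [n|n|n] //=.
  by rewrite mulr_ge0// exprn_ge0.
rewrite /pseries_diffs normrM normrM normrX normr_nat mulrAC mulrC ler_wpM2l//.
rewrite /s exprMn ler_pM// ?exprn_ge0//.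
  by rewrite -natrX ler_nat ltnW// ltn_expl.
rewrite (@le_trans _ _ ((1 + `|t|) ^+ n))//.
  by rewrite lerXn2r// ?nnegrE ?addr_ge0// lerDr.
by rewrite ler_weXn2l// lerDl.
Qed.

Lemma is_derive_entire_series a f : entire_series a f ->
  exists2 g, entire_series (pseries_diffs a) g &
    forall t, is_derive t (1 : R) f (g t).
Proof.
move=> af; have c1 := entire_series_diffs_cvg af.
have af1 : entire_series (pseries_diffs a)
    (fun t => limn (pseries (pseries_diffs a) t)) by move=> u; exact: c1.
exists (fun t => limn (pseries (pseries_diffs a) t)) => // t.
have c2 := entire_series_diffs_cvg af1.
have := @pseries_snd_diffs _ a (`|t| + 1) t.
rewrite (_ : (fun x => _) = f); last first.
  by apply/funext => u; apply/cvg_lim => //; exact: af.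
apply => //.
- by apply/cvg_ex; exists (f (`|t| + 1)); exact: af.
- by rewrite [ltRHS]ger0_norm ?ltrDl// addr_ge0.
Qed.

Lemma entire_series_deriv a f g : entire_series a f ->
  (forall t, is_derive t (1 : R) f (g t)) -> entire_series (pseries_diffs a) g.
Proof.
move=> /is_derive_entire_series[h ah fh] fg t.
have [_ <-] := fg t; have [_ ->] := fh t; exact: ah.
Qed.

Lemma entire_series_at0 a f : entire_series a f -> a 0%N = f 0.
Proof.
move=> /(_ 0) af; apply/esym; rewrite -(cvg_lim _ af)//; apply/cvg_lim => //.
apply: cvg_near_cst; near=> n.
rewrite /pseries /series/= big_mkord.
have : (0 < n)%N by near: n; exact: nbhs_infty_gt.
move=> /prednK <-; rewrite big_ord_recl /= expr0 mulr1 big1 ?addr0// => i _.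
by rewrite exprS mul0r mulr0.
Unshelve. all: by end_near. Qed.

(** The constant terms agree by evaluation at 0, and the series of derivatives
    satisfy the same hypothesis with the coefficients shifted. *)
Lemma entire_series_uniq a b f : entire_series a f -> entire_series b f -> a =1 b.
Proof.
move=> af bf n; elim: n a b f af bf => [|n IHn] a b f af bf.
  by rewrite (entire_series_at0 af) (entire_series_at0 bf).
have [g ag fg] := is_derive_entire_series af.
have := IHn _ _ _ ag (entire_series_deriv bf fg).
by apply: mulfI; rewrite pnatr_eq0.
Qed.

Section Hermite.
Variable (H : nat -> {poly R}).
Hypothesis hH : hermite_polynomials H.

Let a (x : R) : R^nat := fun n => (H n).[x] / n`!%:R.

Lemma hermite_entire x : entire_series (a x) (fun t => expR (2 * x * t - t ^+ 2)).
Proof.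
move=> t; rewrite (_ : pseries _ _ =
  series (fun n => t ^+ n / n`!%:R * (H n).[x])); first exact: hH.
by congr series; apply/funext => n /=; rewrite /a mulrC mulrA mulrAC.
Qed.

Lemma hermite0 : H 0%N = 1.
Proof.
apply/eqP; rewrite -subr_eq0; apply/eqP/poly0_of_horner => x.
have := entire_series_at0 (@hermite_entire x).
by rewrite /a mulr0 expr0n subr0 expR0 invr1 mulr1 !hornerE => ->; rewrite subrr.
Qed.

(** Compares coefficients in d/dt e^(2xt-t^2) = (2x - 2t) e^(2xt-t^2).  At
    [n = 0] the factor [n%:R] kills the spurious term [H n.-1]. *)
Lemma hermite_rec n :
  H n.+1 = 2%:P * 'X * H n - 2%:P * n%:R%:P * H n.-1.
Proof.
apply/eqP; rewrite -subr_eq0; apply/eqP/poly0_of_horner => x.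
pose f (t : R) := expR (2 * x * t - t ^+ 2).
have fE t : is_derive t (1 : R) f ((2 * x - 2 * t) * f t).
  rewrite mulrC; apply: (@is_derive1_comp _ expR (fun t => 2 * x * t - t ^+ 2)).
  by apply: is_derive_eq; rewrite ![_ *: _]mulr1 /=; ring.
have a1 := entire_series_deriv (@hermite_entire x) fE.
pose b n : R := 2 * x * a x n - 2 * (if n is m.+1 then a x m else 0).
have b1 : entire_series b (fun t => (2 * x - 2 * t) * f t).
  move=> t; rewrite mulrBl.
  have -> : pseries b t = (fun N => 2 * x * pseries (a x) t N -
      2 * t * (if N is M.+1 then pseries (a x) t M else 0)).
    apply/funext => -[|N]; first by rewrite /pseries /series/= !big_nil; ring.
    rewrite /pseries /series/= !mulr_sumr [in X in _ - X]big_mkord.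
    rewrite !big_mkord [X in X - _]big_ord_recl [LHS]big_ord_recl /b /=.
    rewrite !expr0 -addrA -sumrB; congr (_ + _); first by ring.
    by apply: eq_bigr => i _; rewrite /bump /= add1n exprS; ring.
  apply: cvgB; apply: cvgM (cvg_cst _) _; first exact: hermite_entire.
  by rewrite -cvg_shiftS; exact: hermite_entire.
have := entire_series_uniq a1 b1 n.
have fN m : m`!%:R != 0 :> R by rewrite pnatr_eq0 -lt0n fact_gt0.
rewrite /pseries_diffs /a /b /a.
case: n => [|n] E.
  rewrite !hornerE /=. move: E. rewrite fact0 mul1r mulr0 subr0 !divr1 => ->.
  by ring.
have nN : n.+1%:R != 0 :> R by rewrite pnatr_eq0.
have n2N : n.+2%:R != 0 :> R by rewrite pnatr_eq0.
have e : (H n.+2).[x] =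
    n.+1`!%:R * (n.+2%:R * ((H n.+2).[x] / n.+2`!%:R)).
  rewrite (factS n.+1) natrM; move: (n.+2%:R) n2N (fN n.+1) => k kN mN.
  by field; rewrite kN mN.
rewrite !hornerE /= e E (factS n) natrM.
move: (fN n) => mN; rewrite -[n.+1%:R]/(n.+1%:R : R).
move: (n.+1%:R : R) nN => k kN; by field; rewrite kN mN.
Qed.

Lemma hermite_deriv n : ((H n)^`() = (2 * n%:R)%:P * H n.-1)%R.
Proof.
(* The three-term recurrence calls for two consecutive indices. *)
suff [] : ((H n)^`() = (2 * n%:R)%:P * H n.-1)%R /\
   ((H n.+1)^`() = (2 * n.+1%:R)%:P * H n)%R by [].
elim: n => [|n [IH0 IH1]].
  rewrite !mulr0 mul0r hermite0 derivC; split=> //.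
  by rewrite hermite_rec hermite0 /= !poly.derivE; ring.
split => //; rewrite hermite_rec /= !poly.derivE IH0 IH1.
transitivity (2%:P * H n.+1 + 2%:P * n.+1%:R%:P * H n.+1).
  by rewrite [X in _ = _ + _ * X]hermite_rec !polyCM; ring.
by rewrite -(natr1 n.+1) !polyCM polyCD; ring.
Qed.

End Hermite.

End HermitePolynomials.

(** * Polynomials with matrix coefficients evaluated at real points *)

Section MatrixPolynomials.
Local Open Scope sesquilinear_scope.
Variables (R : realType) (p : nat).
Local Notation M := 'M[R[i]]_p.+1.
Implicit Types (Q : {poly M}) (x : R) (A : M).

(** Coefficients do not commute, but a scalar argument is central; this is what
    makes evaluation at it multiplicative. *)
Lemma comm_scalarC Q x : comm_poly Q (x%:C)%:M.
Proof. by apply: comm_coef_poly => k; rewrite -!mulmxE scalar_mxC. Qed.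

Lemma mpevalM Q1 Q2 x : mpeval (Q1 * Q2) x = mpeval Q1 x * mpeval Q2 x.
Proof. exact/hornerM_comm/comm_scalarC. Qed.

Lemma mpevalB Q1 Q2 x : mpeval (Q1 - Q2) x = mpeval Q1 x - mpeval Q2 x.
Proof. by rewrite /mpeval hornerD hornerN. Qed.

Lemma mpevalD Q1 Q2 x : mpeval (Q1 + Q2) x = mpeval Q1 x + mpeval Q2 x.
Proof. exact: hornerD. Qed.

Lemma mpevalC A x : mpeval A%:P x = A.
Proof. exact: hornerC. Qed.

Lemma mpevalX x : mpeval 'X x = (x%:C)%:M :> M.
Proof. exact: hornerX. Qed.

Lemma mpevalE Q n x : (size Q <= n)%N ->
  mpeval Q x = \sum_(k < n) (x ^+ k)%:C *: Q`_k.
Proof.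
move=> sQ; rewrite /mpeval (horner_coef_wide _ sQ); apply: eq_bigr => k _.
by rewrite -!rmorphXn/= -mulmxE mul_mx_scalar.
Qed.

(** The definitions of the integral and of the derivative of a matrix function
    go through real and imaginary parts of entries; they are handled uniformly
    as real-linear functionals on matrices. *)
Definition real_linear (f : M -> R) :=
  (forall A B, f (A + B) = f A + f B) /\
  (forall r A, f (r%:C *: A) = r * f A).

Definition Re_entry i j (A : M) : R := complex.Re (A i j).
Definition Im_entry i j (A : M) : R := complex.Im (A i j).

Lemma real_linear_Re i j : real_linear (Re_entry i j).
Proof.
split=> [A B|r A]; rewrite /Re_entry !mxE.
  by case: (A i j) (B i j) => ? ? [].
by case: (A i j) => a b /=; rewrite mul0r subr0.
Qed.

Lemma real_linear_Im i j : real_linear (Im_entry i j).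
Proof.
split=> [A B|r A]; rewrite /Im_entry !mxE.
  by case: (A i j) (B i j) => ? ? [].
by case: (A i j) => a b /=; rewrite mul0r addr0.
Qed.

Section RealLinear.
Variable f : M -> R.
Hypothesis f_lin : real_linear f.

Lemma real_linear0 : f 0 = 0.
Proof.
by have [_ fZ] := f_lin; rewrite -(scale0r 0) -[0 : R[i]]/(0%:C) fZ mul0r.
Qed.

Lemma real_linear_sum n (r : nat -> R) (A : nat -> M) :
  f (\sum_(k < n) (r k)%:C *: A k) = \sum_(k < n) r k * f (A k).
Proof.
have [fD fZ] := f_lin.
elim: n => [|n IHn]; first by rewrite !big_ord0 real_linear0.
by rewrite !big_ord_recr /= fD IHn fZ.
Qed.

Lemma horner_map_real_linear Q x : (map_poly f Q).[x] = f (mpeval Q x).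
Proof.
rewrite (mpevalE _ (leqnn _)) (real_linear_sum _ (fun k => x ^+ k) (fun k => Q`_k)).
rewrite (horner_coef_wide _ (size_poly _ _)); apply: eq_bigr => k _.
by rewrite coef_map_id0 ?real_linear0// mulrC.
Qed.
End RealLinear.

Lemma mpeval_eq0 Q : (forall x, mpeval Q x = 0) -> Q = 0.
Proof.
move=> Q0; apply/polyP => k; rewrite coef0; apply/matrixP => i j.
have H f : real_linear f -> f Q`_k = 0.
  move=> fl; have <- : (map_poly f Q)`_k = f Q`_k.
    by rewrite coef_map_id0 ?real_linear0.
  rewrite (@poly0_of_horner _ (map_poly f Q)) ?coef0//.
  by move=> x; rewrite horner_map_real_linear// Q0 real_linear0.
have := H _ (real_linear_Re i j); have := H _ (real_linear_Im i j).
by rewrite /Re_entry /Im_entry mxE; case: (Q`_k i j) => a b /= -> ->.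
Qed.

Lemma mpeval_inj Q1 Q2 : (forall x, mpeval Q1 x = mpeval Q2 x) -> Q1 = Q2.
Proof.
move=> Q12; apply/eqP; rewrite -subr_eq0; apply/eqP/mpeval_eq0 => x.
by rewrite mpevalB; apply/eqP; rewrite subr_eq0; apply/eqP/Q12.
Qed.

(** The integral of e^(-x^2) Q(x), written through the moments so that its
    algebraic properties are statements on coefficients; [mxintegral_gauss]
    identifies it with the integral. *)
Definition gauss_mxint Q : M := \sum_(k < size Q) (gauss_moment R k)%:C *: Q`_k.

Lemma gauss_mxintE n Q : (size Q <= n)%N ->
  gauss_mxint Q = \sum_(k < n) (gauss_moment R k)%:C *: Q`_k.
Proof.
move=> sQ; rewrite /gauss_mxint.
rewrite (big_ord_widen n (fun k => (gauss_moment R k)%:C *: Q`_k))//.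
rewrite big_mkcond; apply: eq_bigr => i _; case: ltnP => // sQi.
by rewrite nth_default// scaler0.
Qed.

Lemma gauss_mxint_real_linear f Q : real_linear f ->
  f (gauss_mxint Q) =
  (\int[@lebesgue_measure R]_(x in setT) gauss_poly (map_poly f Q) x)%R.
Proof.
move=> fl; rewrite (@Rintegral_gauss_poly _ (size Q)) ?size_poly//.
rewrite (real_linear_sum fl _ (fun k => gauss_moment R k) (fun k => Q`_k)).
by apply: eq_bigr => k _; rewrite coef_map_id0// real_linear0.
Qed.

Lemma mxintegral_gauss F Q :
  (forall x, F x = (expR (- x ^+ 2))%:C *: mpeval Q x) ->
  mxintegral F = gauss_mxint Q.
Proof.
move=> FE; apply/matrixP => i j; rewrite mxE.
have H f : real_linear f ->
    (\int[@lebesgue_measure R]_(x in setT) f (F x))%R = f (gauss_mxint Q).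
  move=> fl; rewrite gauss_mxint_real_linear//; apply: eq_Rintegral => x _.
  by rewrite FE fl.2 /gauss_poly horner_map_real_linear.
have := H _ (real_linear_Re i j); have := H _ (real_linear_Im i j).
rewrite /Re_entry /Im_entry => -> ->.
by case: (gauss_mxint Q i j).
Qed.

Lemma gauss_mxintD Q1 Q2 : gauss_mxint (Q1 + Q2) = gauss_mxint Q1 + gauss_mxint Q2.
Proof.
pose n := maxn (size Q1) (size Q2).
rewrite !(@gauss_mxintE n) ?leq_maxl ?leq_maxr ?size_polyD// -big_split.
by apply: eq_bigr => k _; rewrite coefD scalerDr.
Qed.

Lemma gauss_mxintMl A Q : gauss_mxint (A%:P * Q) = A * gauss_mxint Q.
Proof.
rewrite !(@gauss_mxintE (size Q)) ?mulr_sumr//.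
  by apply: eq_bigr => k _; rewrite coefCM -scalerAr.
by rewrite mul_polyC; exact: size_scale_leq.
Qed.

Lemma gauss_mxintMr A Q : gauss_mxint (Q * A%:P) = gauss_mxint Q * A.
Proof.
rewrite !(@gauss_mxintE (size Q)) ?mulr_suml//.
  by apply: eq_bigr => k _; rewrite coefMC -scalerAl.
by apply/leq_sizeP => j sj; rewrite coefMC nth_default ?mul0r.
Qed.

(** Integration by parts, by way of [gauss_moment_rec]. *)
Lemma gauss_mxint_deriv Q : gauss_mxint Q^`() = gauss_mxint ('X * Q) *+ 2.
Proof.
rewrite (@gauss_mxintE (size Q).+1 ('X * Q)); last first.
  rewrite -commr_polyX; case: (eqVneq Q 0) => [->|?].
    by rewrite mul0r size_poly0.
  by rewrite size_mulX.
rewrite big_ord_recl coefXM scaler0 add0r.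
rewrite (@gauss_mxintE (size Q)); last first.
  by rewrite (leq_trans (size_poly _ _))// leq_pred.
rewrite -sumrMnl.
rewrite (eq_bigr (fun k : 'I_(size Q) =>
   (k.+1%:R * gauss_moment R k)%:C *: Q`_k.+1)); last first.
  move=> k _; rewrite coef_deriv -scaler_nat scalerA mulrC.
  by rewrite rmorphM rmorph_nat.
rewrite [RHS](eq_bigr (fun k : 'I_(size Q) =>
   (k%:R * gauss_moment R k.-1)%:C *: Q`_k)); last first.
  move=> k _; rewrite coefXM /= -scaler_nat scalerA gauss_moment_rec.
  by rewrite rmorphM rmorph_nat.
move En : (size Q) => n; case: n En => [|n] En; first by rewrite !big_ord0.
rewrite big_ord_recr [RHS]big_ord_recl /= [Q`_n.+1]nth_default ?En//.
by rewrite scaler0 addr0 mul0r scale0r add0r.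
Qed.

(** The adjoint at real points: the variable is self-adjoint, so only the
    coefficients are transposed and conjugated. *)
Definition adjp Q : {poly M} := map_poly (fun A => A ^t*) Q.

Lemma adjmx0 : (0 : M) ^t* = 0.
Proof. by apply/matrixP => i j; rewrite !mxE rmorph0. Qed.
Lemma adjmxD (A B : M) : (A + B) ^t* = A ^t* + B ^t*.
Proof. by apply/matrixP => i j; rewrite !mxE rmorphD. Qed.
Lemma adjmxM (A B : M) : (A * B) ^t* = B ^t* * A ^t*.
Proof. by rewrite -!mulmxE trmx_mul map_mxM. Qed.
Lemma adjmxMn (A : M) n : (A *+ n) ^t* = A ^t* *+ n.
Proof. by elim: n => [|n IHn]; rewrite ?mulr0n ?adjmx0// !mulrS adjmxD IHn. Qed.
Lemma adjmxZ r (A : M) : (r%:C *: A) ^t* = r%:C *: A ^t*.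
Proof.
apply/matrixP => i j; rewrite !mxE rmorphM; congr (_ * _); exact: conjc_real.
Qed.

Lemma coef_adjp Q k : (adjp Q)`_k = (Q`_k) ^t*.
Proof. by rewrite coef_map_id0// adjmx0. Qed.

Lemma mpeval_adjp Q x : mpeval (adjp Q) x = (mpeval Q x) ^t*.
Proof.
rewrite (@mpevalE _ (size Q)) ?size_poly// (mpevalE _ (leqnn _)).
under eq_bigr do rewrite coef_adjp -adjmxZ.
rewrite -(big_morph (fun A : M => A ^t*) adjmxD adjmx0)//.
Qed.

Lemma adjpD Q1 Q2 : adjp (Q1 + Q2) = adjp Q1 + adjp Q2.
Proof. by apply/polyP => k; rewrite coefD !coef_adjp coefD adjmxD. Qed.

Lemma adjpM Q1 Q2 : adjp (Q1 * Q2) = adjp Q2 * adjp Q1.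
Proof. by apply: mpeval_inj => x; rewrite mpevalM !mpeval_adjp mpevalM adjmxM. Qed.

Lemma adjpC A : adjp A%:P = (A ^t*)%:P.
Proof.
apply/polyP => k; rewrite coef_adjp !coefC; case: ifP => // _; exact: adjmx0.
Qed.

Lemma adjp_deriv Q : adjp Q^`() = (adjp Q)^`().
Proof. by apply/polyP => k; rewrite coef_adjp !coef_deriv coef_adjp adjmxMn. Qed.

End MatrixPolynomials.

(** * Orthogonal polynomials for a weight satisfying a Pearson equation *)

Section GaussHermitian.
Local Open Scope sesquilinear_scope.
Variables (R : realType) (p : nat).
Local Notation M := 'M[R[i]]_p.+1.
Implicit Types (Q : {poly M}) (x : R) (A : M).
Variable V : {poly M}.

Definition gauss_form Q1 Q2 : M := gauss_mxint (Q1 * V * adjp Q2).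

Lemma gauss_formDl Q1 Q2 Q3 :
  gauss_form (Q1 + Q2) Q3 = gauss_form Q1 Q3 + gauss_form Q2 Q3.
Proof. by rewrite /gauss_form !mulrDl gauss_mxintD. Qed.

Lemma gauss_formDr Q1 Q2 Q3 :
  gauss_form Q1 (Q2 + Q3) = gauss_form Q1 Q2 + gauss_form Q1 Q3.
Proof. by rewrite /gauss_form adjpD mulrDr gauss_mxintD. Qed.

Lemma gauss_formMl A Q1 Q2 : gauss_form (A%:P * Q1) Q2 = A * gauss_form Q1 Q2.
Proof. by rewrite /gauss_form -!mulrA gauss_mxintMl. Qed.

Lemma gauss_formMr A Q1 Q2 :
  gauss_form Q1 (A%:P * Q2) = gauss_form Q1 Q2 * A ^t*.
Proof. by rewrite /gauss_form adjpM adjpC mulrA gauss_mxintMr. Qed.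

(** For the weight W(x) = e^(-x^2) V(x) this reads W' = -2x W + A W + W A^*. *)
Definition pearson A := V^`() = A%:P * V + V * (A ^t*)%:P.

(** If L' = A L with L invertible, this is (Q L)' L^-1: the derivative seen
    through the factorization of the weight. *)
Definition twisted_deriv A Q : {poly M} := Q^`() + Q * A%:P.

(** Both sides of [gauss_form_twisted_deriv] expanded, with the derivative of
    [v] replaced by its value under the Pearson equation. *)
Lemma leibniz_pearson (T : nzRingType) (q q' v s s' a b : T) :
  (q' + q * a) * (v * s) + q * (v * (s' + b * s)) =
  q' * (v * s) + q * ((a * v + v * b) * s + v * s').
Proof.
rewrite !(mulrDl, mulrDr) !mulrA -!addrA; congr (_ + _); congr (_ + _).
exact: addrC.
Qed.

Lemma twisted_derivX A Q :
  twisted_deriv A ('X * Q) = Q + 'X * twisted_deriv A Q.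
Proof.
rewrite /twisted_deriv derivM derivX mul1r (mulrDr 'X Q^`()).
by rewrite addrA (mulrA 'X Q).
Qed.

Lemma twisted_derivD A Q1 Q2 :
  twisted_deriv A (Q1 + Q2) = twisted_deriv A Q1 + twisted_deriv A Q2.
Proof. by rewrite /twisted_deriv derivD (mulrDl Q1 Q2) addrACA. Qed.

Lemma twisted_derivCl A S Q :
  twisted_deriv A (S%:P * Q) = S%:P * twisted_deriv A Q.
Proof.
by rewrite /twisted_deriv deriv_mulC (mulrDr S%:P Q^`()) (mulrA S%:P Q).
Qed.

(** The sum of the two forms integrates e^(-x^2) times the derivative of
    Q1 V Q2^*, by the Pearson equation. *)
Lemma gauss_form_twisted_deriv A Q1 Q2 : pearson A ->
  gauss_form (twisted_deriv A Q1) Q2 + gauss_form Q1 (twisted_deriv A Q2) =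
  gauss_form ('X * Q1) Q2 *+ 2.
Proof.
move=> VE; rewrite /gauss_form /twisted_deriv.
rewrite -!mulrA -gauss_mxint_deriv -gauss_mxintD; congr gauss_mxint.
rewrite adjpD adjpM adjpC adjp_deriv !derivM VE.
exact: leibniz_pearson.
Qed.

Section Orthogonal.
Variable P : nat -> {poly M}.
Hypothesis P_monic : forall n, size (P n) = n.+1 /\ P n \is monic.
Hypothesis P_orth : forall n m, n <> m -> gauss_form (P n) (P m) = 0.

Lemma monic_span n Q : (size Q <= n)%N ->
  exists q : nat -> M, Q = \sum_(k < n) (q k)%:P * P k.
Proof.
elim: n Q => [|n IHn] Q sQ.
  by exists (fun=> 0); rewrite big_ord0; apply/eqP; rewrite -size_poly_leq0.
have [szP lcP] := P_monic n.
have Pn1 : (P n)`_n = 1 by move/monicP: lcP; rewrite lead_coefE szP.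
have /IHn[q Qq] : (size (Q - (Q`_n)%:P * P n)%R <= n)%N.
  apply/leq_sizeP => j; rewrite leq_eqVlt coefB coefCM => /orP[/eqP <-|nj].
    by rewrite Pn1 mulr1 subrr.
  rewrite (nth_default _ (leq_trans sQ nj)) [(P n)`_j]nth_default ?szP//.
  by rewrite mulr0 subrr.
exists (fun k => if k == n then Q`_n else q k).
rewrite big_ord_recr /= eqxx.
rewrite (eq_bigr (fun k : 'I_n => (q k)%:P * P k)); last first.
  by move=> k _; rewrite ltn_eqF.
by rewrite -Qq subrK.
Qed.

Lemma gauss_form_sumr Q n (q : nat -> M) :
  (forall k, (k < n)%N -> gauss_form Q (P k) = 0) ->
  gauss_form Q (\sum_(k < n) (q k)%:P * P k) = 0.
Proof.
elim: n => [|n IHn] Q0.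
  rewrite big_ord0 -[0 in LHS](mul0r 0) -[0 * 0]/(0%:P * 0).
  by rewrite gauss_formMr adjmx0 mulr0.
rewrite big_ord_recr /= gauss_formDr gauss_formMr Q0// mul0r addr0.
by apply: IHn => k kn; apply: Q0; rewrite ltnW.
Qed.

Lemma orthogonal_lower n Q : (size Q <= n)%N -> gauss_form (P n) Q = 0.
Proof.
move=> /monic_span[q ->]; apply: gauss_form_sumr => k kn.
by apply: P_orth => nk; rewrite nk ltnn in kn.
Qed.

Hypothesis V_definite : forall Q, gauss_form Q Q = 0 -> Q = 0.

(** Such a [Q] is orthogonal to its own expansion in the [P m]. *)
Lemma orthogonal_eq0 n Q : (size Q <= n)%N ->
  (forall m, (m < n)%N -> gauss_form Q (P m) = 0) -> Q = 0.
Proof.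
move=> /monic_span[q Qq] Q0; apply: V_definite.
by rewrite [X in gauss_form _ X]Qq; exact: gauss_form_sumr.
Qed.

Variables (A : M) (B C : nat -> M).
Hypothesis VA : pearson A.
Hypothesis C0 : C 0%N = 0.
Hypothesis P_rec : forall n,
  'X * P n = P n.+1 + (B n)%:P * P n + (C n)%:P * mpprev P n.

(** The leading terms of [P n * A] and [A * P n] are both [A], as [P n] is
    monic. *)
Lemma size_twisted_deriv n :
  (size (twisted_deriv A (P n) - A%:P * P n - (C n *+ 2)%:P * mpprev P n)%R <= n)%N.
Proof.
have [szP lcP] := P_monic n.
have Pn1 : (P n)`_n = 1 by move/monicP: lcP; rewrite lead_coefE szP.
apply/leq_sizeP => j nj.
have prev0 : ((C n *+ 2)%:P * mpprev P n)`_j = 0.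
  rewrite coefCM; case: n nj {szP lcP Pn1} => [|n] nj /=; first by rewrite coef0 mulr0.
  by rewrite nth_default ?mulr0// (P_monic n).1.
rewrite coefB prev0 coefB coefD coef_deriv coefMC coefCM.
rewrite (@nth_default _ _ (P n) j.+1) ?szP// mul0rn add0r subr0.
move: nj; rewrite leq_eqVlt => /orP[/eqP <-|nj].
  by rewrite Pn1 mul1r mulr1 subrr.
by rewrite nth_default ?szP// mul0r mulr0 subrr.
Qed.

(** The lowering relation: by [gauss_form_twisted_deriv] the two sides have the
    same products with every [P m], m < n, and their difference has degree
    below n. *)
Lemma lowering n :
  twisted_deriv A (P n) = A%:P * P n + (C n *+ 2)%:P * mpprev P n.
Proof.
apply/eqP; rewrite -subr_eq0 opprD addrA; apply/eqP.
apply: (@orthogonal_eq0 n) => [|m mn]; first exact: size_twisted_deriv.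
have prev0 : forall Q, gauss_form (- Q) (P m) = - gauss_form Q (P m).
  by move=> Q; rewrite -mulN1r -polyCN gauss_formMl mulN1r.
rewrite 2!gauss_formDl !prev0 !gauss_formMl.
have nm : n <> m by move=> nm; rewrite nm ltnn in mn.
rewrite (P_orth nm) mulr0 subr0.
have := gauss_form_twisted_deriv (P n) (P m) VA.
have -> : gauss_form (P n) (twisted_deriv A (P m)) = 0.
  apply: orthogonal_lower; rewrite /twisted_deriv.
  apply/leq_sizeP => j nj; rewrite coefD coef_deriv coefMC.
  have szj : (size (P m) <= j)%N by rewrite (P_monic m).1 (leq_trans mn).
  by rewrite !nth_default ?mul0r ?mul0rn ?addr0// (leq_trans szj).
rewrite addr0 => ->; rewrite P_rec !gauss_formDl !gauss_formMl (P_orth nm).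
rewrite P_orth; last by move=> e; move: mn; rewrite -e ltnNge leqnSn.
by rewrite mulr0 !add0r mulrnAl subrr.
Qed.

(** The additive bookkeeping of [toda_coef].  Each variable is an entry of the
    product that it spells, with w, x, y, z for [P] at n + 1, n, n - 1, n - 2 up
    to a constant factor, c1 for [C n.+1] and the other letters for [A], [B]
    and [C]. *)
Lemma toda_monomials (T : comPzRingType)
    (x bax abx cx c1x aw acy cay bcy cby cz : T) :
  abx - bax + x - (c1x - cx + (c1x - cx)) +
  (acy - cay - (bcy + bcy - (cby + cby))) =
  x + (aw + abx + acy + (cx + cby + cz + (cx + cby + cz))) -
  (aw + (c1x + c1x) + (bax + (bcy + bcy)) + (cay + (cz + cz))).
Proof. by ring. Qed.

(** Apply [twisted_deriv A], which commutes with left multiplication by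
    constants and satisfies the product rule for ['X], to the recurrence for
    ['X * P n] and compare coefficients in the basis [P]. *)
Lemma toda_coef n :
  A * B n - B n * A + 1 = (C n.+1 - C n) *+ 2 /\
  A * C n - C n * A = (B n * C n) *+ 2 - (C n * B n.-1) *+ 2.
Proof.
(* [Z] is the term of [P (n - 2)], which cancels; at [n = 0] everything is
   multiplied by [C 0 = 0]. *)
have [Z XP' DP'] : exists2 Z,
    (C n)%:P * ('X * mpprev P n) = (C n)%:P * (P n + (B n.-1)%:P * mpprev P n + Z) &
    (C n)%:P * twisted_deriv A (mpprev P n) = (C n)%:P * (A%:P * mpprev P n + Z *+ 2).
  case: n => [|n]; first by exists 0; rewrite C0 !mul0r.
  exists ((C n)%:P * mpprev P n); first by rewrite /= P_rec.
  by rewrite /= lowering polyCMn mulrnAl.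
have E : P n + (A%:P * ('X * P n) + ((C n)%:P * ('X * mpprev P n)) *+ 2) =
    (A%:P * P n.+1 + (C n.+1 *+ 2)%:P * P n) +
    (B n)%:P * (A%:P * P n + (C n *+ 2)%:P * mpprev P n) +
    (C n)%:P * (A%:P * mpprev P n + Z *+ 2).
  have := twisted_derivX A (P n).
  rewrite {1}P_rec !twisted_derivD !twisted_derivCl DP' !lowering => ->.
  rewrite mulrDr; congr (_ + (_ + _)); first by rewrite !mulrA commr_polyX.
  by rewrite polyCMn mulrnAl mulrnAr !mulrA commr_polyX.
have {E} : (A * B n - B n * A + 1 - (C n.+1 - C n) *+ 2)%:P * P n +
    (A * C n - C n * A - (B n * C n *+ 2 - C n * B n.-1 *+ 2))%:P * mpprev P n = 0.
  move/eqP: E; rewrite -subr_eq0 => /eqP <-; rewrite P_rec XP'.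
  rewrite !(polyCB, polyCD, polyCN, polyCM, polyCMn) ?polyC1.
  rewrite !(mulrDl, mulrDr, mulNr, mulrnAl, mulrnAr) !mulrA mul1r.
  (* What remains is additive in the monomials; passing to entries makes it an
     identity in a commutative ring. *)
  apply/polyP => k; rewrite !(coefD, coefN, coefMn).
  apply/matrixP => i j; rewrite !mxE.
  exact: toda_monomials.
set a := (X in X%:P * P n); set b := (X in _ + X%:P * _) => E.
have [szP lcP] := P_monic n.
have Pn1 : (P n)`_n = 1 by move/monicP: lcP; rewrite lead_coefE szP.
have a0 : a = 0.
  have := congr1 (fun Q : {poly M} => Q`_n) E.
  rewrite coefD !coefCM Pn1 mulr1 coef0 [(mpprev P n)`_n]nth_default.
    by rewrite mulr0 addr0.
  by case: {E szP lcP Pn1 a b Z XP' DP'} n => [|n]; rewrite /= ?size_poly0// (P_monic n).1.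
have b0 : b = 0.
  move: E; rewrite a0 mul0r add0r {}/b {szP lcP Pn1 a a0 Z XP' DP'}; case: n => [|n].
    by rewrite C0 !(mulr0, mul0r, mul0rn, subr0).
  have [szP lcP] := P_monic n => /= E; set b := (X in X = 0).
  have := congr1 (fun Q : {poly M} => Q`_n) E.
  by move/monicP: lcP; rewrite lead_coefE szP coefCM => -> /=;
    rewrite mulr1 coef0.
by split; apply/eqP; rewrite -subr_eq0; [rewrite -/a a0|rewrite -/b b0].
Qed.

End Orthogonal.
End GaussHermitian.

Section Definite.
Local Open Scope sesquilinear_scope.
Variables (R : realType) (p : nat).
Local Notation M := 'M[R[i]]_p.+1.

Lemma Re_entry_diag_form (G : M) (d : 'rV[R]_p.+1) i :
  Re_entry i i (G *m mxC (diag_mx d) *m G ^t*) =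
  \sum_k d 0 k * (complex.Re (G i k) ^+ 2 + complex.Im (G i k) ^+ 2).
Proof.
rewrite /Re_entry mxE (big_morph (@complex.Re R) (id1 := 0) (op1 := +%R)) //; last first.
  by case=> ? ? [].
apply: eq_bigr => k _.
have -> : mxC (diag_mx d) = diag_mx (\row_l (d 0 l)%:C) :> M.
  by apply/matrixP => u v; rewrite !mxE; case: (u == v).
rewrite mul_mx_diag !mxE; case: (G i k) => a b /=; ring.
Qed.

(** The i-th diagonal entry of the integrand is e^(-x^2) times the sum over k of
    d_k |(Q L)_(i,k)|^2, a nonnegative polynomial, so it vanishes identically;
    then Q L = 0 at every point, where L is invertible. *)
Lemma gauss_form_definite (L : {poly M}) (d : 'rV[R]_p.+1) :
  (forall k, 0 < d 0 k) -> (forall x, mpeval L x \in unitmx) ->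
  forall Q : {poly M},
    gauss_form (L * (mxC (diag_mx d))%:P * adjp L) Q Q = 0 -> Q = 0.
Proof.
move=> d0 Lu Q; rewrite /gauss_form => Q0; apply: mpeval_eq0 => x.
set W := Q * _ * _ in Q0.
have WE y : mpeval W y = (mpeval (Q * L) y) *m mxC (diag_mx d) *m (mpeval (Q * L) y) ^t*.
  rewrite -mpeval_adjp /W adjpM !mulmxE !mpevalM !mulrA.
  by rewrite mpevalC.
suff G0 : mpeval (Q * L) x = 0.
  by rewrite -[LHS](mulmxK (Lu x)) mulmxE -mpevalM G0 -mulmxE mul0mx.
apply/matrixP => i k; rewrite [RHS]mxE.
have fl := @real_linear_Re R p i i.
have pos (G : M) l : 0 <= d 0 l * (complex.Re (G i l) ^+ 2 + complex.Im (G i l) ^+ 2).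
  by rewrite mulr_ge0 ?addr_ge0 ?sqr_ge0// ltW.
have s0 : map_poly (Re_entry i i) W = 0.
  apply: gauss_poly_definite => [y|].
    by rewrite horner_map_real_linear// WE Re_entry_diag_form sumr_ge0.
  by rewrite -gauss_mxint_real_linear// Q0 real_linear0.
have := horner_map_real_linear fl W x.
rewrite s0 horner0 WE Re_entry_diag_form => /esym/eqP.
rewrite psumr_eq0// => /allP/(_ k); rewrite mem_index_enum => /(_ isT)/=.
rewrite mulf_eq0 gt_eqF ?d0//= paddr_eq0 ?sqr_ge0// !sqrf_eq0.
by case: (mpeval _ _ _ _) => a b /= /andP[/eqP -> /eqP ->].
Qed.

End Definite.

(** * Differentiating polynomial matrix functions *)

Section MatrixCurves.
Variables (R : realType) (p : nat).
Local Notation M := 'M[R[i]]_p.+1.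

Lemma deriv_map_real_linear (f : M -> R) (Q : {poly M}) : real_linear f ->
  deriv (map_poly f Q) = map_poly f Q^`()%R.
Proof.
move=> fl; have f0 := real_linear0 fl; apply/polyP => k.
rewrite coef_deriv !coef_map_id0// coef_deriv.
by rewrite -[in RHS]scaler_nat -[k.+1%:R : R[i]](rmorph_nat (real_complex R)) fl.2 mulr_natl.
Qed.

Lemma is_derive_mx (F : R -> 'M[R]_p.+1) t (D : 'M[R]_p.+1) :
  (forall i j, is_derive t (1 : R) (fun s => F s i j) (D i j)) ->
  is_derive t (1 : R) F D.
Proof.
move=> FD; have dF : derivable F t 1.
  by apply/derivable_mxP => i j; have [] := FD i j.
apply: DeriveDef => //; rewrite derive_mx//; apply/matrixP => i j.
by rewrite mxE; have [] := FD i j.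
Qed.

Lemma is_mxderive_mpeval (Q : {poly M}) t :
  is_mxderive (mpeval Q) t (mpeval Q^`()%R t).
Proof.
have H f : real_linear f ->
    is_derive t (1 : R) (fun s => f (mpeval Q s)) (f (mpeval Q^`()%R t)).
  move=> fl; rewrite -horner_map_real_linear// -deriv_map_real_linear//.
  rewrite (_ : (fun s => _) = horner (map_poly f Q)); first exact: is_derive_poly.
  by apply/funext => s; rewrite horner_map_real_linear.
split; apply: is_derive_mx => i j.
- have := H _ (@real_linear_Re R p i j); rewrite /Re_entry => {}H.
  by rewrite mxE; under eq_fun do rewrite mxE.
- have := H _ (@real_linear_Im R p i j); rewrite /Im_entry => {}H.
  by rewrite mxE; under eq_fun do rewrite mxE.
Qed.

End MatrixCurves.

(** * Exponentials of nilpotent matrices as polynomials *)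

Section NilpotentExp.
Variables (R : realType) (p : nat).
Local Notation M := 'M[R[i]]_p.+1.

(** The function t |-> exp(t A), for A nilpotent of order at most the size of
    the matrix. *)
Definition exp_poly (A : M) : {poly M} :=
  \poly_(k < p.+1) ((k`!%:R^-1 : R)%:C *: A ^+ k).

Lemma fact_neq0 k : k`!%:R != 0 :> R.
Proof. by rewrite pnatr_eq0 -lt0n fact_gt0. Qed.

Lemma deriv_exp_poly A : A ^+ p.+1 = 0 ->
  ((exp_poly A)^`() = A%:P * exp_poly A)%R.
Proof.
move=> Ap0; apply/polyP => k; rewrite coef_deriv coefCM !coef_poly.
have [kp|] := ltnP k p.+1; last first.
  by move=> pk; rewrite ltnNge (leq_trans pk (leqnSn _))/= mul0rn mulr0.
rewrite -scalerAr -exprS; move: kp; rewrite ltnS leq_eqVlt => /orP[/eqP ->|kp].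
  by rewrite ltnn mul0rn Ap0 scaler0.
rewrite ltnS kp -scaler_nat scalerA -[k.+1%:R : R[i]](rmorph_nat (real_complex R)) -rmorphM/=.
by rewrite factS natrM invfM mulVKf// pnatr_eq0.
Qed.

Lemma exp_polyC A : A%:P * exp_poly A = exp_poly A * A%:P.
Proof.
apply/polyP => k; rewrite coefCM coefMC coef_poly; case: ifP => _; last by rewrite mulr0 mul0r.
by rewrite -scalerAr -scalerAl -exprS -exprSr.
Qed.

(** The product has derivative 0 since [A] commutes with its exponential, and
    constant coefficient 1. *)
Lemma exp_polyN A : A ^+ p.+1 = 0 -> exp_poly A * exp_poly (- A) = 1.
Proof.
move=> Ap0; set G := _ * _.
have NAp0 : (- A) ^+ p.+1 = 0 by rewrite exprNn Ap0 mulr0.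
have G'0 : G^`()%R = 0.
  rewrite derivM (deriv_exp_poly Ap0) (deriv_exp_poly NAp0) exp_polyC polyCN.
  by rewrite mulNr mulrN (mulrA _ A%:P) subrr.
apply/polyP => -[|k].
  rewrite coef0M !coef_poly /= fact0 invr1 rmorph1 !expr0 scale1r mulr1.
  by rewrite coef1.
have := congr1 (fun Q : {poly M} => Q`_k) G'0; rewrite coef_deriv coef0 coef1.
move/eqP; rewrite -scaler_nat scaler_eq0 pnatr_eq0/=.
by move/eqP.
Qed.

Lemma mxCZ r A : mxC (r *: A) = r%:C *: @mxC R p A.
Proof. by apply/matrixP => i j; rewrite !mxE rmorphM. Qed.

Lemma mxCM A B : mxC (A * B) = @mxC R p A * mxC B.
Proof. by rewrite /mxC -!mulmxE map_mxM. Qed.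

Lemma mxC1 : mxC 1 = 1 :> M.
Proof. by rewrite /mxC map_mx1. Qed.

Lemma mxCX A k : mxC (A ^+ k) = @mxC R p A ^+ k.
Proof. by elim: k => [|k IHk]; rewrite ?mxC1// !exprS mxCM IHk. Qed.

Lemma mxC_sum n (F : nat -> 'M[R]_p.+1) :
  mxC (\sum_(k < n) F k) = \sum_(k < n) mxC (F k).
Proof.
elim: n => [|n IHn]; first by rewrite !big_ord0; apply/matrixP => i j; rewrite !mxE.
by rewrite !big_ord_recr -IHn; apply/matrixP => i j; rewrite !mxE rmorphD.
Qed.

Lemma mxexp_nilpotent (A : 'M[R]_p.+1) : A ^+ p.+1 = 0 ->
  mxexp A = \sum_(k < p.+1) k`!%:R^-1 *: A ^+ k.
Proof.
move=> Ap0; apply/cvg_lim => //; apply: cvg_near_cst; near=> n.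
have pn : (p.+1 <= n)%N by near: n; exact: nbhs_infty_ge.
rewrite /series/= big_mkord -(subnKC pn) big_split_ord/= [X in _ + X]big1 ?addr0//.
by move=> k _; rewrite exprD Ap0 mul0r scaler0.
Unshelve. all: by end_near. Qed.

Lemma mpeval_exp_poly (A : 'M[R]_p.+1) x : A ^+ p.+1 = 0 ->
  mpeval (exp_poly (mxC A)) x = mxC (mxexp (x *: A)).
Proof.
move=> Ap0; rewrite mxexp_nilpotent; last by rewrite exprZn Ap0 scaler0.
rewrite (@mpevalE _ _ _ p.+1) ?size_poly//.
rewrite (mxC_sum _ (fun k => k`!%:R^-1 *: (x *: A) ^+ k)).
apply: eq_bigr => k _; rewrite coef_poly ltn_ord exprZn !mxCZ mxCX.
by rewrite !scalerA mulrC.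
Qed.

End NilpotentExp.
(** * The Hermite type weight *)

Section HermiteWeightTheory.
Local Open Scope sesquilinear_scope.
Variables (R : realType) (p : nat).
Local Notation M := 'M[R[i]]_p.+1.

Lemma Amx_exp k : @Amx R p ^+ k =
  \matrix_(i, j) if i == (j + k)%N :> nat then 2 ^+ k else 0.
Proof.
elim: k => [|k IHk]; apply/matrixP => i j.
  by rewrite !mxE addn0 expr0 -val_eqE /=; case: (_ == _).
rewrite exprSr IHk -mulmxE !mxE.
have [jp|pj] := ltnP j.+1 p.+1; last first.
  rewrite big1 => [|l _]; last first.
    by rewrite !mxE [X in _ * X]ifN ?mulr0// ltn_eqF// (leq_trans (ltn_ord l)).
  rewrite ltn_eqF// addnS ltnS.
  exact: leq_trans (leq_ord i) (leq_trans (pj : (p <= j)%N) (leq_addr _ _)).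
rewrite (bigD1 (Ordinal jp))//= !mxE eqxx big1 ?addr0 => [|l ljp]; last first.
  by rewrite !mxE [X in _ * X]ifN ?mulr0.
by rewrite addSnnS; case: ifP => _; rewrite ?mul0r// -exprSr.
Qed.

Lemma Amx_nilpotent : @Amx R p ^+ p.+1 = 0.
Proof.
rewrite Amx_exp; apply/matrixP => i j; rewrite !mxE ltn_eqF//.
by rewrite (leq_trans (ltn_ord i))// leq_addl.
Qed.

Variable alpha : nat -> R.
Hypothesis alpha_neq0 : forall k, (1 <= k <= p.+1)%N -> alpha k != 0.

Lemma diagmx_unit : diagmx p alpha \in unitmx.
Proof.
rewrite unitmxE det_diag unitfE; apply/prodf_neq0 => i _.
by rewrite mxE; apply: alpha_neq0; exact: ltn_ord.
Qed.

Local Notation conjA := (@conj_alpha R p alpha).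

Lemma conj_alphaM (A B : 'M[R]_p.+1) : conjA (A * B) = conjA A * conjA B.
Proof.
rewrite /conj_alpha -!mulmxE !mulmxA; congr (_ *m _ *m _).
by rewrite mulmxKV ?diagmx_unit.
Qed.

Lemma conj_alpha1 : conjA 1 = 1.
Proof. by rewrite /conj_alpha mulmx1 mulmxV ?diagmx_unit. Qed.

Lemma conj_alphaX (A : 'M[R]_p.+1) k : conjA (A ^+ k) = conjA A ^+ k.
Proof. by elim: k => [|k IHk]; rewrite ?conj_alpha1// !exprS conj_alphaM IHk. Qed.

Lemma conj_alphaZ r (A : 'M[R]_p.+1) : conjA (r *: A) = r *: conjA A.
Proof. by rewrite /conj_alpha -scalemxAr -scalemxAl. Qed.

Lemma conj_alpha_sum n (F : nat -> 'M[R]_p.+1) :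
  conjA (\sum_(k < n) F k) = \sum_(k < n) conjA (F k).
Proof. by rewrite /conj_alpha mulmx_sumr mulmx_suml. Qed.

Lemma conj_Amx_nilpotent : conjA (Amx p) ^+ p.+1 = 0.
Proof.
by rewrite -conj_alphaX Amx_nilpotent /conj_alpha mulmx0 mul0mx.
Qed.

Variable H : nat -> {poly R}.
Hypothesis hH : hermite_polynomials H.

(** [Amx p] is twice the lower shift, so L(x) is the sum of the H_k(x)/k! times
    the powers of [Amx p / 2]; with this scaling differentiation lowers the
    index by one. *)
Definition scaled_hermite k : {poly R} := (k`!%:R * 2 ^+ k)^-1 *: H k.

Lemma scaled_hermite_neq0 k : k`!%:R * 2 ^+ k != 0 :> R.
Proof. by rewrite mulf_neq0 ?fact_neq0// expf_neq0// pnatr_eq0. Qed.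

Lemma deriv_scaled_hermite k :
  deriv (scaled_hermite k) = if k is l.+1 then scaled_hermite l else 0.
Proof.
rewrite /scaled_hermite derivZ hermite_deriv//.
case: k => [|k]; first by rewrite mulr0 mul0r scaler0.
rewrite mul_polyC scalerA; congr (_ *: _).
rewrite factS natrM exprS; have := scaled_hermite_neq0 k.
rewrite mulf_eq0 negb_or => /andP[k0 k2].
have : k.+1%:R != 0 :> R by rewrite pnatr_eq0.
move: (k.+1%:R : R) => c c0 /=.
by field; rewrite k0 c0 k2.
Qed.

Lemma Lmx_scaled_hermite x :
  Lmx p H x = \sum_(k < p.+1) (scaled_hermite k).[x] *: Amx p ^+ k.
Proof.
apply/matrixP => i j; rewrite summxE mxE.
under eq_bigr do rewrite Amx_exp !mxE.
have [ji|ij] := leqP j i; last first.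
  rewrite big1// => k _; rewrite ltn_eqF ?mulr0//.
  by rewrite (leq_trans ij)// leq_addr.
have ijp : (i - j < p.+1)%N by rewrite (leq_ltn_trans (leq_subr _ _)).
rewrite (bigD1 (Ordinal ijp))//= big1 ?addr0 => [|k kij]; last first.
  rewrite ifN ?mulr0//; apply: contra kij => /eqP ik.
  by apply/eqP/val_inj; rewrite /= ik addKn.
rewrite subnKC// eqxx /scaled_hermite hornerZ.
have := scaled_hermite_neq0 (i - j)%N.
rewrite mulf_eq0 negb_or => /andP[k0 k2].
by field; rewrite k0 k2.
Qed.

Definition scalarC (r : R) : M := (r%:C)%:M.

Lemma scalarC0 : scalarC 0 = 0.
Proof. by apply/matrixP => i j; rewrite !mxE mul0rn. Qed.

Local Notation Aa := (mxC (conjA (Amx p))).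

(** The polynomial whose values are L^alpha(x). *)
Definition hermite_poly_mx : {poly M} :=
  \sum_(k < p.+1) map_poly scalarC (scaled_hermite k) * (Aa ^+ k)%:P.

Lemma mpeval_map_scalarC (q : {poly R}) x :
  mpeval (map_poly scalarC q) x = (q.[x]%:C)%:M.
Proof.
rewrite (@mpevalE _ _ _ (size q)) ?size_poly// horner_coef rmorph_sum raddf_sum.
apply: eq_bigr => k _ /=; rewrite coef_map_id0 ?scalarC0//.
by rewrite /scalarC scale_scalar_mx -rmorphM mulrC.
Qed.

Lemma mpeval_hermite_poly_mx x :
  mpeval hermite_poly_mx x = mxC (conjA (Lmx p H x)).
Proof.
rewrite Lmx_scaled_hermite.
rewrite (conj_alpha_sum _ (fun k => (scaled_hermite k).[x] *: Amx p ^+ k)).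
rewrite (mxC_sum _ (fun k => conjA ((scaled_hermite k).[x] *: Amx p ^+ k))).
rewrite /mpeval /hermite_poly_mx horner_sum; apply: eq_bigr => k _.
rewrite conj_alphaZ conj_alphaX mxCZ mxCX -/(mpeval _ x) mpevalM.
by rewrite mpeval_map_scalarC mpevalC -mulmxE mul_scalar_mx.
Qed.

(** Differentiation shifts the index of the Hermite polynomials by one and
    multiplication by A shifts the exponent of A by one; the two boundary terms
    vanish because the first Hermite polynomial is constant and A is
    nilpotent. *)
Lemma deriv_hermite_poly_mx :
  deriv hermite_poly_mx = Aa%:P * hermite_poly_mx.
Proof.
have mapD q : deriv (map_poly scalarC q) = map_poly scalarC q^`()%R.
  apply/polyP => k; rewrite coef_deriv !coef_map_id0 ?scalarC0// coef_deriv.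
  by rewrite /scalarC rmorphMn raddfMn.
rewrite /hermite_poly_mx raddf_sum mulr_sumr /=.
under eq_bigr do rewrite derivM derivC mulr0 addr0 mapD deriv_scaled_hermite.
rewrite big_ord_recl [RHS]big_ord_recr /=.
rewrite map_poly0 mul0r add0r.
have swap q A : A%:P * map_poly scalarC q = map_poly scalarC q * A%:P.
  apply/polyP => k; rewrite coefCM coefMC coef_map_id0 ?scalarC0//.
  by rewrite /scalarC -!mulmxE scalar_mxC.
under [in RHS]eq_bigr do rewrite mulrA swap -mulrA -polyCM -exprS.
rewrite mulrA swap -mulrA -polyCM -exprS -mxCX conj_Amx_nilpotent.
have -> : mxC 0 = 0 :> M by apply/matrixP => i j; rewrite !mxE.
by rewrite polyC0 mulr0 addr0.
Qed.

Lemma Lmx_unit x : Lmx p H x \in unitmx.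
Proof.
rewrite unitmxE det_trig.
  rewrite big1 ?unitr1// => i _; rewrite mxE leqnn subnn hermite0//.
  by rewrite hornerC fact0 divr1.
by apply/is_trig_mxP => i j ij; rewrite mxE leqNgt ij.
Qed.

Lemma mpeval_hermite_unit x : mpeval hermite_poly_mx x \in unitmx.
Proof.
rewrite mpeval_hermite_poly_mx /mxC map_unitmx /conj_alpha.
by rewrite !unitmx_mul unitmx_inv diagmx_unit Lmx_unit.
Qed.

Variable delta : nat -> R.

Definition hermite_weight_poly : {poly M} :=
  hermite_poly_mx * (mxC (diagmx p delta))%:P * adjp hermite_poly_mx.

Lemma hermite_weightE x : hermite_weight p H alpha delta x =
  (expR (- x ^+ 2))%:C *: mpeval hermite_weight_poly x.
Proof.
rewrite /hermite_weight /hermite_weight_poly !mpevalM mpeval_adjp.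
by rewrite mpeval_hermite_poly_mx mpevalC -!mulmxE.
Qed.

Lemma pearson_hermite : pearson hermite_weight_poly Aa.
Proof.
rewrite /pearson /hermite_weight_poly !derivM derivC mulr0 addr0.
by rewrite -adjp_deriv deriv_hermite_poly_mx adjpM adjpC !mulrA.
Qed.

Lemma mxintegral_hermite_weight (Q1 Q2 : {poly M}) :
  mxintegral (fun x => mpeval Q1 x *m hermite_weight p H alpha delta x
    *m (mpeval Q2 x) ^t*) = gauss_form hermite_weight_poly Q1 Q2.
Proof.
apply: mxintegral_gauss => x.
rewrite hermite_weightE !mpevalM !mpeval_adjp -!mulmxE.
by rewrite -scalemxAr -scalemxAl.
Qed.

End HermiteWeightTheory.

(** * The Toda flow *)

Section TodaFlow.
Variables (R : realType) (p : nat).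
Local Notation M := 'M[R[i]]_p.+1.

(** [U] and [V] stand for exp(-t h) and exp(t h), where 2 h = A, and [c2] for
    one half: conjugation turns the commutator with [h] into the derivative,
    and the linear term -t/2 of B_n(t), being central, drops out of the
    commutator with C_n(t). *)
Lemma toda_flow (U V : {poly M}) (h c2 : M) (B C : nat -> M) :
  V * U = 1 -> U * V = 1 ->
  deriv U = - (U * h%:P) -> deriv V = h%:P * V ->
  (forall X, c2 * X = X * c2) ->
  (forall n, h * B n - B n * h + c2 = C n.+1 - C n) ->
  (forall n, h * C n - C n * h = B n * C n - C n * B n.-1) ->
  toda_lattice (fun n => mpeval (U * (B n)%:P * V - c2%:P * 'X))
    (fun n => mpeval (U * (C n)%:P * V)).
Proof.
move=> VU UV dU dV c2C hB hC.
have c2X Q : (c2%:P * 'X) * Q = Q * (c2%:P * 'X).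
  rewrite -mulrA -(commr_polyX Q) !mulrA; congr (_ * 'X); apply/polyP => k.
  by rewrite coefCM coefMC.
have conjP X Y : (U * X%:P * V) * (U * Y%:P * V) = U * (X * Y)%:P * V.
  by rewrite polyCM !mulrA -[_ * V * U]mulrA VU mulr1.
have conjB X Y : U * (X - Y)%:P * V = U * X%:P * V - U * Y%:P * V.
  by rewrite polyCB mulrBr mulrBl.
have dconj X : deriv (U * X%:P * V) = U * (X * h - h * X)%:P * V.
  rewrite (derivM (U * _)) (derivM U) derivC mulr0 addr0 dU dV.
  rewrite (conjB (X * h) (h * X)) (polyCM X h) (polyCM h X) !mulNr addrC.
  by rewrite !mulrA.
move=> t; split => [n _|n].
  rewrite !mulmxE -!mpevalM -mpevalB mulrBr mulrBl !conjP c2X opprB addrA subrK.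
  rewrite -conjB; have -> : C n * B n.-1 - B n * C n = C n * h - h * C n.
    by rewrite -opprB -hC opprB.
  rewrite -(dconj (C n)); exact: is_mxderive_mpeval.
rewrite -mpevalB -conjB -[C n - _]opprB -hB.
have -> : U * (- (h * B n - B n * h + c2))%:P * V =
    deriv (U * (B n)%:P * V - c2%:P * 'X).
  rewrite derivB dconj deriv_mulC derivX mulr1 opprD opprB conjB.
  congr (_ - _); rewrite -[RHS]mulr1 -UV mulrA; congr (_ * V).
  by apply/polyP => k; rewrite coefCM coefMC c2C.
exact: is_mxderive_mpeval.
Qed.

End TodaFlow.

Theorem proposition5p1 (R : realType) (p : nat)
  (H : nat -> {poly R}) (hH : hermite_polynomials H)
  (alpha : nat -> R)
  (halpha : forall k, (1 <= k <= p.+1)%N -> alpha k != 0)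
  (halpha1 : alpha 1%N = 1)
  (nu0 : R) (delta : R -> nat -> R) (c d : R -> R)
  (hdelta : forall j k : nat, (1 <= k <= p.+1)%N -> 0 < delta (nu0 + j%:R) k)
  (hc : forall j : nat, 0 < c (nu0 + j%:R))
  (hd : forall j : nat, 0 < d (nu0 + j%:R))
  (hDelta : forall j : nat, let nu := nu0 + j%:R in
     diagmx p (delta (nu + 1)) =
     (d nu *: Jmx p + (c nu)%:M) *m diagmx p (delta nu))
  (hratio : forall j k : nat, let nu := nu0 + j%:R in
     (1 <= k < p.+1)%N ->
     alpha k.+1 ^+ 2 / alpha k ^+ 2 =
     d nu * k%:R * (p.+1 - k)%:R / (2 * (d nu * k%:R + c nu))
       * (delta nu k.+1 / delta nu k))
  (nu : R) (hnu : exists j : nat, nu = nu0 + j%:R)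
  (P : nat -> {poly 'M[R[i]]_p.+1})
  (hP : monic_orthogonal (hermite_weight p H alpha (delta nu)) P)
  (B C : nat -> 'M[R[i]]_p.+1)
  (hBC : three_term_recurrence P B C) :
  let A := conj_alpha alpha (Amx p) in
  let E (s : R) := mxC (mxexp (s *: A)) in
  let Ct n (t : R) := E (- (t / 2)) *m C n *m E (t / 2) in
  let Bt n (t : R) := E (- (t / 2)) *m B n *m E (t / 2) - ((t / 2)%:C)%:M in
  toda_lattice Bt Ct.
Proof.
move=> A E Ct Bt.
case: hP => P_monic P_orth; case: hBC => C0 P_rec.
have A_nil : A ^+ p.+1 = 0 := conj_Amx_nilpotent halpha.
have ZA_nil r : (r *: A) ^+ p.+1 = 0 by rewrite exprZn A_nil scaler0.
(* The exponents are multiples of t / 2, so half of [A] generates the flow. *)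
pose h : 'M[R[i]]_p.+1 := mxC (2^-1 *: A).
have hA : mxC A = h *+ 2.
  rewrite /h mxCZ -scaler_nat scalerA -[2%:R : R[i]](rmorph_nat (real_complex R)).
  by rewrite -rmorphM mulfV ?pnatr_eq0// rmorph1 scale1r.
have coef n : mxC A * B n - B n * mxC A + 1 = (C n.+1 - C n) *+ 2 /\
    mxC A * C n - C n * mxC A = (B n * C n) *+ 2 - (C n * B n.-1) *+ 2.
  apply: (@toda_coef _ _ (hermite_weight_poly p alpha H (delta nu)) P) => //.
  - by move=> k m km; rewrite -mxintegral_hermite_weight//; exact: P_orth.
  - apply: gauss_form_definite => [k|x].
      by rewrite mxE; have [j ->] := hnu; apply: hdelta; exact: ltn_ord.
    exact: mpeval_hermite_unit.
  - exact: pearson_hermite.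
  - move=> k; apply: mpeval_inj => x.
    rewrite !mpevalD !mpevalM !mpevalC mpevalX -!mulmxE.
    by rewrite mul_scalar_mx P_rec.
have NhE : - h = mxC (- 2^-1 *: A) by rewrite /h !mxCZ rmorphN scaleNr.
have h_nil : h ^+ p.+1 = 0.
  by rewrite /h -mxCX ZA_nil; apply/matrixP => i j; rewrite !mxE.
have Nh_nil : (- h) ^+ p.+1 = 0 by rewrite exprNn h_nil mulr0.
have EV t : E (t / 2) = mpeval (exp_poly h) t.
  by rewrite (mpeval_exp_poly t (ZA_nil 2^-1)) scalerA.
have EU t : E (- (t / 2)) = mpeval (exp_poly (- h)) t.
  by rewrite NhE (mpeval_exp_poly t (ZA_nil (- 2^-1))) scalerA mulrN.
pose c2 : 'M[R[i]]_p.+1 := (2^-1%:C)%:M.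
have c2E : c2 *+ 2 = 1.
  by rewrite /c2 -raddfMn -rmorphMn /= -mulr_natr mulVf ?pnatr_eq0.
have double_inj (X Y : 'M[R[i]]_p.+1) : X *+ 2 = Y *+ 2 -> X = Y.
  move=> /eqP; rewrite -subr_eq0 -mulrnBl -scaler_nat scaler_eq0 pnatr_eq0/=.
  by rewrite subr_eq0 => /eqP.
have CtE : Ct = fun n => mpeval (exp_poly (- h) * (C n)%:P * exp_poly h).
  apply/funext => n; apply/funext => t.
  by rewrite /Ct EU EV !mpevalM mpevalC -!mulmxE.
have BtE : Bt = fun n =>
    mpeval (exp_poly (- h) * (B n)%:P * exp_poly h - c2%:P * 'X).
  apply/funext => n; apply/funext => t.
  rewrite /Bt EU EV mpevalB !mpevalM !mpevalC mpevalX -!mulmxE.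
  by rewrite /c2 -scalar_mxM -rmorphM [in RHS]mulrC.
rewrite CtE BtE; apply: (@toda_flow _ _ _ _ h).
- exact: exp_polyN.
- by have := exp_polyN Nh_nil; rewrite opprK.
- by rewrite deriv_exp_poly// exp_polyC polyCN mulrN.
- exact: deriv_exp_poly.
- by move=> X; rewrite -!mulmxE scalar_mxC.
- move=> n; apply: double_inj; have [<- _] := coef n.
  by rewrite !mulrnDl mulNrn c2E hA mulrnAl mulrnAr.
- move=> n; apply: double_inj; have [_ E2] := coef n.
  by rewrite !mulrnBl -E2 hA mulrnAl mulrnAr.
Qed.
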